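(* Let $m \geq 1$ be an integer, let $N$ be an odd positive integer, and let $q \in \mathbb{C}$ be any primitive $N$th root of unity. Then $$\sum_{N-1 \geq n_m \geq \cdots \geq n_1 \geq 0} (-q^{2n_1+2})_{2n_m-2n_1}(-1)^{n_m}q^{-(n_m+1)^2}(q^2;q^2)_{n_1} \prod_{i=1}^{m-1} q^{2n_i^2+2n_i} \begin{bmatrix} n_{i+1} \\ n_i \end{bmatrix}_{q^2}$$ $$= \sum_{N-1 \geq n_m \geq \cdots \geq n_1 \geq 0} (-q^{2n_1+1})_{2n_m-2n_1}(-1)^{n_m}q^{-n_m^2}(q;q^2)_{n_1} \prod_{i=1}^{m-1} q^{2n_i^2+2n_i} \begin{bmatrix} n_{i+1} \\ n_i \end{bmatrix}_{q^2},$$ where both sums run over integer tuples $(n_1,\dots,n_m)$ satisfying the displayed inequalities.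
   Context: For a non-negative integer $n$, $(a;q)_n = \prod_{k=0}^{n-1}(1-aq^k)$, and $(a)_n$ denotes $(a;q)_n$; $(q^2;q^2)_n=\prod_{k=1}^n(1-q^{2k})$ and $(q;q^2)_n=\prod_{k=0}^{n-1}(1-q^{2k+1})$. The $q$-binomial coefficient (Gaussian polynomial) is $\begin{bmatrix} n \\ k \end{bmatrix}_q = \frac{(q;q)_n}{(q;q)_{n-k}(q;q)_k}$ if $0 \leq k \leq n$ and $0$ otherwise; it is a polynomial in $q$, and at a root of unity it means the value of this polynomial. $\begin{bmatrix} n \\ k \end{bmatrix}_{q^2}$ is the same polynomial with $q$ replaced by $q^2$. Empty products equal $1$. *)

(* Defs.v *)
From mathcomp Require Import all_boot all_order all_algebra.
From mathcomp Require Import reals complex.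

Set Implicit Arguments.
Unset Strict Implicit.
Unset Printing Implicit Defensive.

Import GRing.Theory.

#[global] Open Scope ring_scope.

(* (a; q)_n *)
Definition qpoch (R : nzRingType) (a q : R) (n : nat) : R :=
  \prod_(0 <= k < n) (1 - a * q ^+ k).

(* The denominator divides the numerator in {poly F}, so the Euclidean quotient
   is the exact one; evaluating it at a root of unity is then meaningful even
   when the denominator vanishes there. *)
Definition gauss_poly (F : fieldType) (n k : nat) : {poly F} :=
  if (k <= n)%N then
    qpoch 'X 'X n %/ (qpoch 'X 'X (n - k) * qpoch 'X 'X k)
  else 0.

Definition qbinom (F : fieldType) (n k : nat) (q : F) : F :=
  (gauss_poly F n k).[q].

(* Entries are indexed from 1: [entry n 1], ..., [entry n m]. *)
Definition entry (m N : nat) (n : m.-tuple 'I_N) (i : nat) : nat :=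
  nth 0%N [seq val j | j <- n] i.-1.

Definition nondecreasing (m N : nat) (n : m.-tuple 'I_N) : bool :=
  sorted leq [seq val j | j <- n].

(* Main.v *)
Require Import Defs.
From mathcomp Require Import all_boot all_order all_algebra.
From mathcomp Require Import reals complex.
From mathcomp Require Import qpoly qfpoly separable.
From mathcomp Require Import ring zify.

Set Implicit Arguments.
Unset Strict Implicit.
Unset Printing Implicit Defensive.

Import GRing.Theory.

(** The two multisums have the same inner part, an iteration of the Bailey
    chain relative to $a = q^2$ in base $q^2$.  Let $N = M+1$ and let $T$ be
    the lower triangular matrix with entries
    $q^{2j^2+2j} [i, j]_{q^2}$ for $0 \le i, j \le M$.  Each side is then
    $u T^{m-1} b$ for a row $u$, collecting the factors in $n_m$, and a
    column $b$, collecting the factors in $n_1$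
    ([sum_nondecreasing], [summandL], [summandR]).

    Generically $T$ is diagonalised by the Bailey transform, with eigenvalues
    $q^{2r^2+2r}$.  At a root of unity the eigenvalues for $r$ and $M - r$
    collide and the transform degenerates.  What survives is a bidiagonal
    matrix $X$ commuting with $T$ ([bailey_op], [transfer_comm]), whose
    diagonal entries are $x_r = q^{-2r} + q^{2r+2}$, and for which the first
    basis column $e_0$ and the last basis row $f_M$ are cyclic
    ([newton_ecol], [erow_newton]).  Hence $b = A(X) e_0$ and
    $u = 2 f_M A'(X)$ for polynomials $A$ and $A'$, so that
    $u T^{m-1} b = 2 f_M T^{m-1} (A A')(X) e_0$.  With $B$ and $B'$ for
    the other side, it is enough that $A A' - B B'$ be divisible by the
    product of the $x - x_r$ for $r \le M$, in which $x_r = x_{M-r}$ makes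
    almost all roots double ([newton_dvd_defect]).

    Parametrise $x = q^2 v^2 + v^{-2}$, with $v$ equal to $q^r$ up to an
    infinitesimal, so that values also record first derivatives.  The claim
    follows from two relations with the same factor,
    $(qv + 1/v) A = B$ ([kappa_L]) and $A' = (qv + 1/v) B'$
    ([dual_kappa]).  In each, both sides satisfy q-difference equations under
    $v \mapsto qv$, obtained by telescoping; the boundary terms vanish
    because a full period of factors is divisible by $(1-v^N)^2$.  The
    difference of the two sides then satisfies a homogeneous equation, and
    going once around the $N$-cycle multiplies it by $-1$ up to an
    infinitesimal, as $N$ is odd; therefore it is zero ([shift_vanish]).  The
    only closed evaluation needed is that of a balanced sum, and it is
    determined by its value near $v = 1$ ([saal_sum_base],
    [saal_sum_shift]). *)

(** * q-shifted factorials *)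
Section QPoch.
Variable C : comNzRingType.
Implicit Types a q : C.

Lemma qpoch0 a q : qpoch a q 0 = 1.
Proof. by rewrite /qpoch big_geq. Qed.

Lemma qpochSr a q n : qpoch a q n.+1 = qpoch a q n * (1 - a * q ^+ n).
Proof. by rewrite /qpoch big_nat_recr. Qed.

Lemma qpochSl a q n : qpoch a q n.+1 = (1 - a) * qpoch (a * q) q n.
Proof.
rewrite /qpoch big_nat_recl // expr0 mulr1; congr (_ * _).
by apply: eq_bigr => k _; rewrite exprS mulrA.
Qed.
End QPoch.

(** * Contiguous relations for the sums attached to a point y *)

Section Telescoping.
Variable C : comNzRingType.
Implicit Types (q y v : C) (c : nat -> C).

(** The value of [psi] at the point [y], with [y'] its inverse, is
    $(q^2y;q^2)_n(1/y;q^2)_n$, a polynomial of degree [n] in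
    [q ^+ 2 * y + y'].  Replacing [y] by [y / q ^+ 2] amounts to swapping the
    two arguments (see [bsum_shift]), so no division of [y] is ever needed. *)
Definition psi q (y y' : C) n := qpoch (q ^+ 2 * y) (q ^+ 2) n * qpoch y' (q ^+ 2) n.
(** The factor that [psi q y y' n.+1] and [psi q y' y n.+1] have in common; it
    is symmetric in [y] and [y'], and all telescoping happens over it. *)
Definition theta q (y y' : C) n :=
  qpoch (q ^+ 2 * y) (q ^+ 2) n * qpoch (q ^+ 2 * y') (q ^+ 2) n.
Definition bsum q c N (y y' : C) := \sum_(n < N) c n * q ^+ n.*2 * psi q y y' n.

Lemma psi0 q y y' : psi q y y' 0 = 1.
Proof. by rewrite /psi !qpoch0 mulr1. Qed.
Lemma theta0 q y y' : theta q y y' 0 = 1.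
Proof. by rewrite /theta !qpoch0 mulr1. Qed.
Lemma psiS q y y' n :
  psi q y y' n.+1 = theta q y y' n * ((1 - q ^+ n.*2.+2 * y) * (1 - y')).
Proof.
rewrite /psi /theta qpochSr qpochSl [y' * _]mulrC -exprM mul2n.
rewrite !exprS; ring.
Qed.
Lemma thetaS q y y' n :
  theta q y y' n.+1
  = theta q y y' n * ((1 - q ^+ n.*2.+2 * y) * (1 - q ^+ n.*2.+2 * y')).
Proof.
by rewrite /theta !qpochSr -exprM mul2n !exprS; ring.
Qed.

Lemma bsumS q c N y y' : bsum q c N.+1 y y' =
  bsum q c N y y' + c N * q ^+ N.*2 * psi q y y' N.
Proof. by rewrite /bsum big_ord_recr. Qed.
Lemma bsum1 q c y y' : bsum q c 1 y y' = c 0%N.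
Proof. by rewrite /bsum big_ord1 psi0 expr0 !mulr1. Qed.

(** With the coefficients $c_n = 1/(-q;q)_{2n+1}$, the [n.+1]-st term of the
    left-hand side is [(1 - y) ^+ 2] times the difference of
    [c n * theta q y y' n] between two consecutive indices, so the sum
    telescopes.  This first-order q-difference equation characterises the sum
    at a root of unity. *)
Lemma bsum_recL q y y' c M : y * y' = 1 -> c 0%N * (1 + q) = 1 ->
  (forall n, (n < M)%N ->
     c n.+1 * ((1 + q ^+ n.*2.+2) * (1 + q ^+ n.*2.+3)) = c n) ->
  (1 + q * y) * bsum q c M.+1 y y' + y * (y + q) * bsum q c M.+1 y' y
  = 2 * y + (1 - y) ^+ 2 * (c M * theta q y y' M).
Proof.
move=> yy c0; elim: M => [|M IH] cS.
  rewrite !bsum1 theta0.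
  have -> : 2 * y = 2 * y * (c 0%N * (1 + q)) by rewrite c0 mulr1.
  ring.
rewrite !(bsumS _ _ M.+1).
rewrite mulrDr [_ * (bsum _ _ _ y' y + _)]mulrDr addrACA IH; last by move=> n /ltnW; exact: cS.
have thC : theta q y' y M = theta q y y' M by rewrite /theta mulrC.
rewrite -(cS M (ltnSn M)) !psiS thC thetaS.
rewrite doubleS !exprS; set e := q ^+ _; set t := theta _ _ _ _.
ring: yy.
Qed.

(** Same mechanism for $b_n = 1/((q^2;q^2)_n(-q;q)_{2n+1})$ and
    $a_n = 1/((q^2;q^2)_n(-q;q)_{2n})$: the difference of the two sides
    telescopes.  It ties the first sum at [y] to the second one at the
    neighbouring point [y / q ^+ 2]. *)
Lemma bsum_contiguous q y y' a b M : y * y' = 1 ->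
  (forall n, b n * (1 + q ^+ n.*2.+1) = a n) ->
  (forall n, (n < M)%N ->
     b n.+1 * ((1 - q ^+ n.*2.+2) * (1 + q ^+ n.*2.+2) * (1 + q ^+ n.*2.+3)) = b n) ->
  bsum q a M.+1 y y'
  = (y + q) * bsum q b M.+1 y' y + (1 - y) * (b M * theta q y y' M).
Proof.
move=> yy ba; elim: M => [|M IH] bS.
  by rewrite !bsum1 theta0 -ba expr1; ring.
rewrite !(bsumS _ _ M.+1) mulrDr IH; last by move=> n /ltnW; exact: bS.
rewrite -!ba -(bS M (ltnSn M)) !psiS thetaS.
have -> : theta q y' y M = theta q y y' M by rewrite /theta mulrC.
rewrite doubleS !exprS; set e := q ^+ _; set t := theta _ _ _ _.
ring: yy.
Qed.

(** Termwise identity.  It trades a sum over [psi] for the sum over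
    $(y;q^2)_n(1/y;q^2)_n$, which for the coefficients of interest is
    balanced, hence summable in the manner of Pfaff and Saalschuetz. *)
Lemma bsum_recR q y y' c M : y * y' = 1 ->
  bsum q c M y y' + y * bsum q c M y' y =
  (1 + y) * \sum_(n < M) c n * q ^+ n.*2 * (qpoch y (q ^+ 2) n * qpoch y' (q ^+ 2) n).
Proof.
move=> yy; rewrite /bsum !mulr_sumr -big_split; apply: eq_bigr => -[[|n] _] _ /=.
  rewrite !psi0 !qpoch0; ring.
rewrite !psiS !qpochSl.
have -> : theta q y' y n = theta q y y' n by rewrite /theta mulrC.
rewrite /theta [y * q ^+ 2]mulrC [y' * q ^+ 2]mulrC doubleS.
set e := q ^+ _.+2; set t := qpoch _ _ _; set t' := qpoch _ _ _.
ring: yy.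
Qed.

(** The balanced sum at a general [y] is truncated and has no product formula,
    but it keeps the q-difference equation that the Pfaff-Saalschuetz formula
    would imply, up to the boundary term of a telescoping sum.  The summand
    certificate is [(1 - q * y)] times
    $b_n(1-q^{2n+1})(q^2y;q^2)_n(1/y;q^2)_n$. *)
Lemma saal_sum_shift q y y' z z' b M : y * y' = 1 -> z = q ^+ 2 * y -> y' = q ^+ 2 * z' ->
  b 0%N = 1 ->
  (forall n, (n < M)%N ->
     b n.+1 * ((1 - q ^+ n.*2.+2) * (1 + q ^+ n.*2.+1) * (1 + q ^+ n.*2.+2))
     = b n * (1 - q ^+ n.*2.+1)) ->
  (1 + z) * \sum_(n < M.+1) b n * q ^+ n.*2 * (qpoch z (q ^+ 2) n * qpoch z' (q ^+ 2) n)
  = q * ((1 + y) *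
      \sum_(n < M.+1) b n * q ^+ n.*2 * (qpoch y (q ^+ 2) n * qpoch y' (q ^+ 2) n))
    + (1 - q * y) * (b M * (1 - q ^+ M.*2.+1) *
                      (qpoch z (q ^+ 2) M * qpoch y' (q ^+ 2) M)).
Proof.
move=> yy zE y'E b0; elim: M => [|M IH] bS.
  rewrite !big_ord1 !qpoch0 b0 expr1 expr0 zE; ring.
rewrite 2!(big_ord_recr M.+1) /= mulrDr IH; last by move=> n /ltnW; exact: bS.
rewrite -(bS M (ltnSn M)).
rewrite (qpochSl z') (qpochSl y) (qpochSr y') (qpochSr z) -!exprM mul2n.
have -> : z' * q ^+ 2 = y' by rewrite y'E mulrC.
have -> : y * q ^+ 2 = z by rewrite zE mulrC.
rewrite doubleS !exprS.
set e := q ^+ _; set t := qpoch _ _ _; set t' := qpoch _ _ _.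
set S := \sum_(i < _) _.
rewrite zE; have yz : y * z' * q ^+ 2 = 1 by rewrite -yy y'E; ring.
rewrite y'E.
ring: yz.
Qed.

End Telescoping.

(** * First-order deformations of roots of unity *)

Section RootOfUnity.
Variables (C : comNzRingType) (q q' h : C) (M : nat).
Hypotheses (qq' : q * q' = 1) (h2 : 2 * h = 1) (oddN : odd M.+1).
Hypothesis qN : q ^+ M.+1 = 1.
Hypothesis cyclo : forall y y' : C, y * y' = 1 -> qpoch y (q ^+ 2) M.+1 = 1 - y ^+ M.+1.
(** [C] will be a ring of dual numbers, and [near_root v] says that [v] is an
    [M.+1]-st root of unity up to an infinitesimal.  The infinitesimal is
    what makes double zeros of polynomials visible. *)
Let near_root (v : C) := (1 - v ^+ M.+1) ^+ 2 = 0.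

Lemma two_regular (x : C) : 2 * x = 0 -> x = 0.
Proof. by move=> x2; rewrite -[x]mul1r -h2 mulrAC x2 mul0r. Qed.

Lemma one_plus_regular (w x : C) : (1 - w) ^+ 2 = 0 -> (1 + w) * x = 0 -> x = 0.
Proof.
move=> w0 wx; apply/two_regular/two_regular.
have -> : 2 * (2 * x) = (1 - w) ^+ 2 * x + (3 - w) * ((1 + w) * x) by ring.
by rewrite w0 wx mul0r mulr0 addr0.
Qed.

Lemma near_root_exp v k : near_root v -> near_root (v ^+ k).
Proof.
rewrite /near_root -exprM mulnC exprM => v0; set V := v ^+ _ in v0 *.
by rewrite -[1](expr1n _ k) subrXX exprMn v0 mul0r.
Qed.

Lemma near_root_shift v : near_root v -> near_root (q * v).
Proof. by rewrite /near_root exprMn qN mul1r. Qed.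

(** [M.+1] factors complete a period, so the boundary term is a multiple of
    [(1 - y ^+ M.+1) ^+ 2]. *)
Lemma theta_boundary y y' : y * y' = 1 -> near_root y ->
  (1 - y) ^+ 2 * theta q y y' M = 0.
Proof.
move=> yy y0; have y'y : y' * y = 1 by rewrite mulrC.
have -> : (1 - y) ^+ 2 * theta q y y' M =
  - y * (qpoch y (q ^+ 2) M.+1 * qpoch y' (q ^+ 2) M.+1).
  rewrite !qpochSl /theta [y * q ^+ 2]mulrC [y' * q ^+ 2]mulrC.
  set t := qpoch _ _ _; set t' := qpoch _ _ _; ring: yy.
rewrite (cyclo yy) (cyclo y'y).
have yyN : y ^+ M.+1 * y' ^+ M.+1 = 1 by rewrite -exprMn yy expr1n.
have -> : (1 - y ^+ M.+1) * (1 - y' ^+ M.+1) = - (1 - y ^+ M.+1) ^+ 2 * y' ^+ M.+1.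
  set Y := y ^+ _ in yyN *; set Y' := y' ^+ _ in yyN *; ring: yyN.
by rewrite y0 oppr0 !mul0r mulr0.
Qed.

(** Writing [y = v ^+ 2], half of the factor [(1 - y) ^+ 2] already suffices:
    [1 + v] divides [1 + v ^+ M.+1] because [M.+1] is odd, and the latter is
    invertible. *)
Lemma theta_boundary_half v v' : v * v' = 1 -> near_root v ->
  (1 - v) ^+ 2 * theta q (v ^+ 2) (v' ^+ 2) M = 0.
Proof.
move=> vv v0; have yy : v ^+ 2 * v' ^+ 2 = 1 by rewrite -exprMn vv expr1n.
have := theta_boundary yy (near_root_exp 2 v0).
set t := theta _ _ _ _ => t0.
have {t0} : (1 + v) * ((1 + v) * ((1 - v) ^+ 2 * t)) = 0.
  by rewrite -t0; ring.
have cancel x : (1 + v) * x = 0 -> x = 0.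
  move=> vx; apply: (one_plus_regular v0).
  have : v ^+ M.+1 - (-1) ^+ M.+1 = v ^+ M.+1 + 1 by rewrite -signr_odd oddN opprK.
  rewrite [1 + _ ^+ M.+1]addrC => <-; rewrite subrXX opprK [v + 1]addrC.
  by rewrite mulrAC vx mul0r.
by move/cancel/cancel.
Qed.

(** Uniqueness for homogeneous q-difference equations: going once around the
    orbit of [v] under multiplication by [q] returns [f v v'] multiplied by
    [- v ^+ (M.+1 * k)], which is [- 1] up to an infinitesimal, and [2] is
    invertible. *)
Lemma shift_vanish (P : C -> C -> Prop) (f : C -> C -> C) (k : nat) v v' :
  (forall w w', P w w' -> P (q * w) (q' * w')) ->
  (forall w w', P w w' -> f (q * w) (q' * w') = - ((q * w) ^+ k * f w w')) ->
  near_root v -> P v v' -> f v v' = 0.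
Proof.
move=> Pshift fS v0 Pv.
have Piter j : P (q ^+ j * v) (q' ^+ j * v').
  by elim: j => [|j IH]; rewrite ?expr0 ?mul1r // !exprS -!mulrA; apply: Pshift.
have iter j : f (q ^+ j * v) (q' ^+ j * v')
    = (-1) ^+ j * (q ^+ 'C(j.+1, 2) * v ^+ j) ^+ k * f v v'.
  elim: j => [|j IH]; first by rewrite !expr0 !mul1r expr1n mul1r.
  rewrite [in LHS]exprS [q' ^+ _]exprS -!mulrA fS; last exact: Piter.
  have -> : q ^+ 'C(j.+2, 2) * v ^+ j.+1
      = (q * (q ^+ j * v)) * (q ^+ 'C(j.+1, 2) * v ^+ j).
    by rewrite binS bin1 exprD !exprS; ring.
  by rewrite IH exprS [(_ * (_ * v) * _) ^+ k]exprMn; ring.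
have q'N : q' ^+ M.+1 = 1 by rewrite -[LHS]mul1r -qN -exprMn qq' expr1n.
have qbin : q ^+ 'C(M.+2, 2) = 1.
  by rewrite binS bin1 bin2odd // exprD exprM qN expr1n mul1r.
have := iter M.+1.
rewrite qN q'N !mul1r qbin mul1r -signr_odd oddN expr1 mulN1r => fE.
apply: (one_plus_regular (near_root_exp k v0)).
rewrite exprAC in fE *.
by rewrite mulrDl mul1r {1}fE mulNr addNr.
Qed.

Lemma bsum_shift c N y y' :
  bsum q c N (q' ^+ 2 * y') (q ^+ 2 * y) = bsum q c N y y'.
Proof.
apply: eq_bigr => n _; congr (_ * _).
by rewrite /psi mulrA -exprMn qq' expr1n mul1r mulrC.
Qed.

(** The balanced sum of [bsum_recR], normalised so that its value is [2 * v] at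
    [y = v ^+ 2] (lemmas [saal_sum_base] and [saal_unit_shift]). *)
Definition saal_sum (b : nat -> C) y y' := (1 + y) *
  \sum_(n < M.+1) b n * q ^+ n.*2 * (qpoch y (q ^+ 2) n * qpoch y' (q ^+ 2) n).

Let near_unit v v' := v * v' = 1 /\ near_root v.

Lemma near_unit_shift v v' : near_unit v v' -> near_unit (q * v) (q' * v').
Proof.
case=> vv v0; split; last exact: near_root_shift.
by rewrite mulrACA qq' vv mulr1.
Qed.

Lemma near_unit_sq v v' : near_unit v v' -> near_unit (v ^+ 2) (v' ^+ 2).
Proof.
by case=> vv v0; split; [rewrite -exprMn vv expr1n | exact: near_root_exp].
Qed.

Section Kappa.
Variables (a b a_dual b_dual : nat -> C).
Hypothesis a0 : a 0%N * (1 + q) = 1.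
Hypothesis aS : forall n, (n < M)%N ->
  a n.+1 * ((1 + q ^+ n.*2.+2) * (1 + q ^+ n.*2.+3)) = a n.
Hypothesis b0 : b 0%N = 1.
Hypothesis bS : forall n, (n < M)%N ->
  b n.+1 * ((1 - q ^+ n.*2.+2) * (1 + q ^+ n.*2.+1) * (1 + q ^+ n.*2.+2))
  = b n * (1 - q ^+ n.*2.+1).
Hypothesis bM : b M * (1 - q ^+ M.*2.+1) = 0.
Hypothesis dualE : forall n, b_dual n * (1 + q ^+ n.*2.+1) = a_dual n.
Hypothesis b_dualS : forall n, (n < M)%N ->
  b_dual n.+1 * ((1 - q ^+ n.*2.+2) * (1 + q ^+ n.*2.+2) * (1 + q ^+ n.*2.+3)) = b_dual n.

Let saal_unit v v' := near_unit v v' /\ saal_sum b (v ^+ 2) (v' ^+ 2) = 2 * v.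

Lemma saal_unit_shift v v' : saal_unit v v' -> saal_unit (q * v) (q' * v').
Proof.
case=> vu vg; split; first exact: near_unit_shift.
have [vv _] := vu.
have [yy _] := near_unit_sq vu.
rewrite /saal_sum (@saal_sum_shift C q (v ^+ 2) (v' ^+ 2)) // ?exprMn //.
- by rewrite bM mul0r mulr0 addr0 -/(saal_sum _ _ _) vg; ring.
- by rewrite mulrA -exprMn qq' expr1n mul1r.
Qed.

(** Both sums obey first-order q-difference equations with the same right-hand
    side once the first is multiplied by [q * v + v'], by [bsum_recL] and
    [bsum_recR]; hence they agree. *)
Lemma kappa_L v v' : saal_unit v v' ->
  (q * v + v') * bsum q a M.+1 (v ^+ 2) (v' ^+ 2) = bsum q b M.+1 (v ^+ 2) (v' ^+ 2).
Proof.
move=> Pv.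
pose f v v' := (q * v + v') * bsum q a M.+1 (v ^+ 2) (v' ^+ 2)
   - bsum q b M.+1 (v ^+ 2) (v' ^+ 2).
apply/eqP; rewrite -subr_eq0 -/(f v v'); apply/eqP.
apply: (shift_vanish (P := saal_unit) (k := 2)) => //; first exact: saal_unit_shift;
  last by case: Pv => [[]].
move=> {Pv v v'} w w' Pw.
have [wu wg] := saal_unit_shift Pw; have [ww w0] := wu.
have [yy y0] := near_unit_sq wu.
have eA := bsum_recL yy a0 aS.
rewrite [_ ^+ 2 * (a M * _)]mulrCA theta_boundary // mulr0 addr0 in eA.
have eB := bsum_recR q b M.+1 yy.
rewrite -/(saal_sum _ _ _) wg in eB.
rewrite /f -(bsum_shift a _ (w ^+ 2)) -(bsum_shift b _ (w ^+ 2)) -!exprMn.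
have -> : q * w + w' = q * w + q * (q' * w') by rewrite mulrA qq' mul1r.
set u := q * w in yy ww eA eB *; set u' := q' * w' in yy ww eA eB *.
move: (bsum _ _ _ _ _) (bsum _ _ _ _ _) (bsum _ _ _ _ _) (bsum _ _ _ _ _) eA eB.
move=> B' B A' A eA eB.
apply/eqP; rewrite -subr_eq0; apply/eqP.
transitivity (u' * ((1 + q * u ^+ 2) * A + u ^+ 2 * (u ^+ 2 + q) * A'
                    - u * (B + u ^+ 2 * B'))); first ring: ww.
by rewrite eA eB; ring.
Qed.

(** The same factor [q * v + v'] relates the two dual sums.  Combining
    [bsum_contiguous] at [y] and at its inverse gives a homogeneous equation
    for the difference; the two boundary terms do not vanish separately, but
    their combination carries [(1 - v) ^+ 2]. *)
Lemma dual_kappa v v' : near_unit v v' ->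
  bsum q a_dual M.+1 (v ^+ 2) (v' ^+ 2) = (q * v + v') * bsum q b_dual M.+1 (v ^+ 2) (v' ^+ 2).
Proof.
move=> Pv.
pose f v v' := bsum q a_dual M.+1 (v ^+ 2) (v' ^+ 2)
   - (q * v + v') * bsum q b_dual M.+1 (v ^+ 2) (v' ^+ 2).
apply/eqP; rewrite -subr_eq0 -/(f v v'); apply/eqP.
apply: (shift_vanish (P := near_unit) (k := 1)) => //; first exact: near_unit_shift;
  last by case: Pv.
move=> {Pv v v'} w w' Pw.
have wu := near_unit_shift Pw; have [ww w0] := wu.
have [yy y0] := near_unit_sq wu.
have y'y : (q' * w') ^+ 2 * (q * w) ^+ 2 = 1 by rewrite mulrC.
have e1 := bsum_contiguous yy dualE b_dualS.
have e2 := bsum_contiguous y'y dualE b_dualS.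
have thC y y' : theta q y' y M = theta q y y' M by rewrite /theta mulrC.
rewrite thC in e2.
have tb := theta_boundary_half ww w0.
rewrite /f -(bsum_shift a_dual _ (w ^+ 2)) -(bsum_shift b_dual _ (w ^+ 2)) -!(exprMn 2) expr1.
have -> : q * w + w' = q * w + q * (q' * w') by rewrite mulrA qq' mul1r.
set u := q * w in yy ww e1 e2 tb *; set u' := q' * w' in yy ww e1 e2 tb *.
move: (theta _ _ _ _) (bsum _ _ _ _ _) (bsum _ _ _ _ _) (bsum _ _ _ _ _) (bsum _ _ _ _ _)
  e1 e2 tb.
move=> t B A' B' A -> -> tb.
apply/eqP; rewrite -subr_eq0; apply/eqP.
transitivity (- (b_dual M * u' * (1 + u)) * ((1 - u) ^+ 2 * t)); last by rewrite tb mulr0.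
ring: ww.
Qed.

(** At a point infinitesimally close to [1] only the term of index [0]
    survives, because all others contain [(1 - y) * (1 - y')]. *)
Lemma saal_sum_base v v' : v * v' = 1 -> (1 - v) ^+ 2 = 0 ->
  saal_sum b (v ^+ 2) (v' ^+ 2) = 2 * v.
Proof.
move=> vv v0; rewrite /saal_sum big_ord_recl big1 => [|i _].
  rewrite /= !qpoch0 b0 expr0 !mulr1 addr0.
  by apply/eqP; rewrite -subr_eq0 -v0; apply/eqP; ring.
rewrite /= /bump /= !qpochSl; set t := qpoch _ _ _; set t' := qpoch _ _ _.
transitivity ((1 - v) ^+ 2 * (- (1 + v) ^+ 2 * v' ^+ 2 *
  (b (1 + i)%N * q ^+ (1 + i).*2 * (t * t')))); last by rewrite v0 mul0r.
ring: vv.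
Qed.

Lemma kappa_orbit v v' r : v * v' = 1 -> (1 - v) ^+ 2 = 0 ->
  let y := (q ^+ r * v) ^+ 2 in let y' := (q' ^+ r * v') ^+ 2 in
  bsum q a M.+1 y y' * bsum q a_dual M.+1 y y' = bsum q b M.+1 y y' * bsum q b_dual M.+1 y y'.
Proof.
move=> vv v0 y y'.
have Pr : saal_unit (q ^+ r * v) (q' ^+ r * v').
  elim: r {y y'} => [|r IH]; last by rewrite !exprS -!mulrA; apply: saal_unit_shift.
  rewrite !expr0 !mul1r; split; last exact: saal_sum_base.
  split=> //; rewrite /near_root.
  by rewrite -[1](expr1n _ M.+1) subrXX exprMn v0 mul0r.
rewrite (dual_kappa Pr.1) -(kappa_L Pr); ring.
Qed.
End Kappa.

End RootOfUnity.

(** * Coefficient sequences and their polynomials *)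
Lemma dvdp_double_roots (F : fieldType) (p : {poly F}) (s t : seq F) :
  uniq s -> uniq t -> {subset t <= s} -> all (root p) s -> all (root p^`()) t ->
  \prod_(x <- s) ('X - x%:P) * \prod_(x <- t) ('X - x%:P) %| p.
Proof.
move=> us ut tS ps pt.
have /dvdpP[r pE] : \prod_(x <- s) ('X - x%:P) %| p.
  by apply: uniq_roots_dvdp; rewrite // uniq_rootsE.
rewrite {}pE in ps pt *; rewrite mulrC dvdp_mul2r ?monic_neq0 ?monic_prod_XsubC //.
apply: uniq_roots_dvdp; last by rewrite uniq_rootsE.
apply/allP => x xt; have xs := tS x xt.
have rx : root (\prod_(x <- s) ('X - x%:P)) x by rewrite root_prod_XsubC.
have sep : separable_poly (\prod_(x <- s) ('X - x%:P)).
  by rewrite separable_prod_XsubC.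
have dx : (\prod_(x <- s) ('X - x%:P))^`().[x] != 0.
  by apply: coprimep_root rx; move: sep; rewrite unlock.
move/allP: pt => /(_ x xt).
rewrite derivM /root hornerD !hornerM (rootP rx) mulr0 add0r mulf_eq0.
by rewrite (negbTE dx) orbF.
Qed.

Section Coefficients.
Variables (F : fieldType) (M : nat) (q : F).
Hypotheses (nz2 : 2%:R != 0 :> F) (oddN : odd M.+1) (prim : M.+1.-primitive_root q).

Lemma q_neq0 : q != 0.
Proof.
by apply: contra_eq_neq (prim_expr_order prim) => ->; rewrite expr0n eq_sym oner_eq0.
Qed.

Lemma one_plus_expq_neq0 k : 1 + q ^+ k != 0.
Proof.
apply/negP => /eqP k0; have qk : q ^+ k = -1 by apply/eqP; rewrite -addr_eq0 addrC k0.
have : (q ^+ k) ^+ M.+1 = 1 by rewrite exprAC (prim_expr_order prim) expr1n.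
rewrite qk -signr_odd oddN expr1 => /eqP.
by rewrite eq_sym -addr_eq0 -mulr2n (negbTE nz2).
Qed.

(** Oddness of the order makes [q ^+ 2] as good as [q]. *)
Lemma expq2_eq1 k : (q ^+ k.*2 == 1) = (M.+1 %| k)%N.
Proof.
by rewrite -(prim_order_dvd prim) -mul2n Gauss_dvdr // coprimen2.
Qed.

Lemma prim_sq : M.+1.-primitive_root (q ^+ 2).
Proof.
by rewrite (prim_root_exp_coprime 2 prim) coprime2n.
Qed.

Lemma qpoch_neg_neq0 n : qpoch (- q) q n != 0.
Proof.
rewrite /qpoch prodf_seq_neq0; apply/allP => k _ /=.
by rewrite mulNr opprK -exprS one_plus_expq_neq0.
Qed.

Lemma qpoch_sq_neq0 n : (n <= M)%N -> qpoch (q ^+ 2) (q ^+ 2) n != 0.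
Proof.
move=> nM; rewrite /qpoch prodf_seq_neq0; apply/allP => k.
rewrite mem_index_iota => /andP[_ kn] /=.
rewrite -exprS -exprM mul2n subr_eq0 eq_sym expq2_eq1 gtnNdvd //.
by rewrite ltnS (leq_trans kn).
Qed.

Lemma qpoch_prim (z : F) (C : comNzRingType) (f : {rmorphism F -> C}) (y y' : C) :
  M.+1.-primitive_root z -> y * y' = 1 -> qpoch y (f z) M.+1 = 1 - y ^+ M.+1.
Proof.
move=> zprim yy.
have /(congr1 (fun p => (map_poly f p).[y'])) := factor_Xn_sub_1 zprim.
rewrite rmorph_prod horner_prod rmorphB rmorph1 /= map_polyXn hornerD hornerN hornerXn hornerC.
move=> /(congr1 ( *%R (y ^+ M.+1))).
rewrite mulrBr mulr1 -exprMn yy expr1n => <-.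
have -> : y ^+ M.+1 = \prod_(i < M.+1) y by rewrite prodr_const card_ord.
rewrite /qpoch !big_mkord -big_split.
apply: eq_bigr => i _ /=.
by rewrite rmorphB /= map_polyX map_polyC hornerXsubC mulrBr yy /= rmorphXn.
Qed.

Lemma qpoch_period (C : comNzRingType) (f : {rmorphism F -> C}) (y y' : C) :
  y * y' = 1 -> qpoch y (f q ^+ 2) M.+1 = 1 - y ^+ M.+1.
Proof. by rewrite -rmorphXn; apply: qpoch_prim; exact: prim_sq. Qed.

(** Bailey-pair data: [betaL] and [betaR] are the sequences from which the two
    multisums start, each divided by $(q^2;q^2)_n$.  [dualL] and [dualR]
    come from the factors that depend on the largest index, after that index
    has been reflected ([topL_dual], [topR_dual]). *)
Definition betaL n := (qpoch (- q) q n.*2.+1)^-1.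
Definition dualL n := (qpoch (q ^+ 2) (q ^+ 2) n * qpoch (- q) q n.*2)^-1.
Definition betaR n := qpoch q (q ^+ 2) n * dualL n.
Definition dualR n := (qpoch (q ^+ 2) (q ^+ 2) n * qpoch (- q) q n.*2.+1)^-1.

Lemma betaL0 : betaL 0 * (1 + q) = 1.
Proof.
by rewrite /betaL qpochSr qpoch0 mul1r expr0 mulr1 opprK mulVf // -[q]expr1 one_plus_expq_neq0.
Qed.

Let qpN n : qpoch (- q) q n.+1 = qpoch (- q) q n * (1 + q ^+ n.+1).
Proof. by rewrite qpochSr mulNr opprK -exprS. Qed.
Let qpS n : qpoch (q ^+ 2) (q ^+ 2) n.+1 = qpoch (q ^+ 2) (q ^+ 2) n * (1 - q ^+ n.*2.+2).
Proof. by rewrite qpochSr -exprS -exprM mul2n. Qed.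

Lemma betaLS n : betaL n.+1 * ((1 + q ^+ n.*2.+2) * (1 + q ^+ n.*2.+3)) = betaL n.
Proof.
rewrite /betaL doubleS (qpN n.*2.+2) (qpN n.*2.+1).
have h1 := qpoch_neg_neq0 n.*2.+1.
have h2 := one_plus_expq_neq0 n.*2.+2; have h3 := one_plus_expq_neq0 n.*2.+3.
by field; rewrite h1 h2 h3.
Qed.

Lemma betaR0 : betaR 0 = 1.
Proof. by rewrite /betaR /dualL double0 !qpoch0 mulr1 invr1 mulr1. Qed.

Lemma betaRS n : (n < M)%N ->
  betaR n.+1 * ((1 - q ^+ n.*2.+2) * (1 + q ^+ n.*2.+1) * (1 + q ^+ n.*2.+2))
  = betaR n * (1 - q ^+ n.*2.+1).
Proof.
move=> nM; rewrite /betaR /dualL doubleS (qpN n.*2.+1) (qpN n.*2).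
have := qpoch_sq_neq0 nM; have := qpoch_sq_neq0 (ltnW nM).
rewrite qpS (qpochSr q) -exprM mul2n -exprS mulf_eq0 negb_or => h0 /andP[_ h1].
have h2 := qpoch_neg_neq0 n.*2.
have h3 := one_plus_expq_neq0 n.*2.+1; have h4 := one_plus_expq_neq0 n.*2.+2.
by field; rewrite h0 h1 h2 h3 h4.
Qed.

Lemma betaRM : betaR M * (1 - q ^+ M.*2.+1) = 0.
Proof.
rewrite /betaR mulrAC.
have -> : qpoch q (q ^+ 2) M * (1 - q ^+ M.*2.+1) = qpoch q (q ^+ 2) M.+1.
  by rewrite qpochSr -exprM mul2n -exprS.
rewrite (@qpoch_period F idfun q q^-1) ?divff ?q_neq0 //.
by rewrite (prim_expr_order prim) subrr mul0r.
Qed.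

Lemma dualRE n : dualR n * (1 + q ^+ n.*2.+1) = dualL n.
Proof.
by rewrite /dualR /dualL qpN mulrA invfM mulfVK // one_plus_expq_neq0.
Qed.

Lemma dualRS n : (n < M)%N ->
  dualR n.+1 * ((1 - q ^+ n.*2.+2) * (1 + q ^+ n.*2.+2) * (1 + q ^+ n.*2.+3)) = dualR n.
Proof.
move=> nM; rewrite /dualR doubleS (qpN n.*2.+2) (qpN n.*2.+1).
have := qpoch_sq_neq0 nM; have := qpoch_sq_neq0 (ltnW nM).
rewrite qpS mulf_eq0 negb_or => h0 /andP[_ h1].
have h2 := qpoch_neg_neq0 n.*2.+1.
have h3 := one_plus_expq_neq0 n.*2.+2; have h4 := one_plus_expq_neq0 n.*2.+3.
by field; rewrite h0 h1 h2 h3 h4.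
Qed.

(** Newton basis for the interpolation nodes [eigen] below: up to a scalar,
    [newton n] is the product of ['X - (eigen q i)%:P] over [i < n]
    ([newton_eigen]).  In the variable [q ^+ 2 * y + y'] it is [psi]. *)
Definition newton n : {poly F} :=
  \prod_(0 <= i < n) ((1 + q ^+ i.*2.*2.+2)%:P - q ^+ i.*2 *: 'X).
(** Bailey inversion in disguise: for generic [q], the value at the node
    [eigen q r] is, up to a factor depending only on [r], the member
    $\alpha_r$ of the Bailey pair whose $\beta_n$ is [c n]. *)
Definition beta_poly (c : nat -> F) := \sum_(n < M.+1) (c n * q ^+ n.*2) *: newton n.

Lemma newton_eval (C : comNzRingType) (f : {rmorphism F -> C}) (y y' : C) n : y * y' = 1 ->
  (map_poly f (newton n)).[f q ^+ 2 * y + y'] = psi (f q) y y' n.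
Proof.
move=> yy; elim: n => [|n IH]; first by rewrite /newton big_geq // rmorph1 hornerC psi0.
rewrite /newton big_nat_recr //= rmorphM hornerM IH /psi !qpochSr mulrACA; congr (_ * _).
rewrite rmorphB /= map_polyC map_polyZ map_polyX hornerD hornerC hornerN hornerZ hornerX.
have f1 k : f (1 + q ^+ k) = 1 + f q ^+ k by rewrite rmorphD rmorph1 rmorphXn.
rewrite [X in X - _](f1 _) [X in _ - X * _](rmorphXn f) /= -!exprM mul2n !exprS.
rewrite -[n.*2.*2]addnn exprD.
set e := f q ^+ _; ring: yy.
Qed.

Lemma beta_poly_eval (C : comNzRingType) (f : {rmorphism F -> C}) (y y' : C) c : y * y' = 1 ->
  (map_poly f (beta_poly c)).[f q ^+ 2 * y + y'] = bsum (f q) (fun n => f (c n)) M.+1 y y'.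
Proof.
move=> yy; rewrite /beta_poly rmorph_sum horner_sum; apply: eq_bigr => n _ /=.
by rewrite map_polyZ hornerZ newton_eval // rmorphM rmorphXn.
Qed.

End Coefficients.

(** * The defect polynomial has double roots at the nodes *)

Section QuotientZero.
Variables (F : fieldType) (p : {poly F}).
Hypotheses (p1 : (1 < size p)%N) (pm : p \is monic).

Lemma in_qpoly_eq0 (r : {poly F}) : (in_qpoly p r == 0) = (p %| r).
Proof.
rewrite -val_eqE /= /mk_monic p1 pm /= -Pdiv.IdomainMonic.modpE //.
Qed.
End QuotientZero.

Section Defect.
Variables (F : fieldType) (M : nat) (q : F).
Hypotheses (nz2 : 2%:R != 0 :> F) (oddN : odd M.+1) (prim : M.+1.-primitive_root q).

Definition eigen r := q ^+ r.*2.+2 + (q ^+ r.*2)^-1.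

Lemma eigen_sub i j : eigen i - eigen j
  = (q ^+ i.*2 - q ^+ j.*2) * (q ^+ (i + j).+1.*2 - 1) / q ^+ (i + j).*2.
Proof.
rewrite /eigen !doubleS doubleD !exprS !exprD.
have hi : q ^+ i.*2 != 0 by rewrite expf_neq0 // (q_neq0 prim).
have hj : q ^+ j.*2 != 0 by rewrite expf_neq0 // (q_neq0 prim).
by field; rewrite hi hj.
Qed.

Lemma eigen_inj i j : (i + j < M)%N -> eigen i = eigen j -> i = j.
Proof.
move=> ijM /eqP; rewrite -subr_eq0 eigen_sub !mulf_eq0 invr_eq0 expf_eq0.
rewrite (negbTE (q_neq0 prim)) andbF orbF !subr_eq0 (expq2_eq1 oddN prim) gtnNdvd // orbF.
rewrite -!mul2n !exprM (eq_prim_root_expr (prim_sq oddN prim)) !modn_small; first by move/eqP.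
all: by move: ijM; clear; lia.
Qed.

(** What has to vanish modulo [newton q M.+1]; see [newton_dvd_defect]. *)
Definition defect : {poly F} :=
  beta_poly M q (betaL q) * beta_poly M q (dualL q)
  - beta_poly M q (betaR q) * beta_poly M q (dualR q).

(** By [kappa_L] and [dual_kappa] both products are equal to
    [(q * v + v')] times the product of the sums attached to [betaL] and
    [dualR]. *)
Lemma beta_dual_orbit (C : comNzRingType) (f : {rmorphism F -> C}) (v v' : C) r :
  v * v' = 1 -> (1 - v) ^+ 2 = 0 ->
  let y := (f q ^+ r * v) ^+ 2 in let y' := (f q^-1 ^+ r * v') ^+ 2 in
  let P c := bsum (f q) (fun n => f (c n)) M.+1 y y' in
  P (betaL q) * P (dualL q) = P (betaR q) * P (dualR q).
Proof.
move=> vv v0 y y' P.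
have fE := (rmorphXn f, rmorphB f, rmorphD f, rmorph1 f, rmorphM f).
apply: (@kappa_orbit _ (f q) (f q^-1) (f 2^-1) M) => //.
- by rewrite -rmorphM divff ?rmorph1 // (q_neq0 prim).
- by rewrite -(rmorph_nat f 2) -rmorphM divff ?rmorph1.
- by rewrite -rmorphXn (prim_expr_order prim) rmorph1.
- by move=> z z'; apply: (qpoch_period oddN prim).
- by have /(congr1 f) := betaL0 nz2 oddN prim; rewrite !fE.
- by move=> n nM; have /(congr1 f) := betaLS nz2 oddN prim n; rewrite !fE.
- by rewrite betaR0 rmorph1.
- by move=> n nM; have /(congr1 f) := betaRS nz2 oddN prim nM; rewrite !fE.
- by have /(congr1 f) := betaRM oddN prim; rewrite !fE rmorph0.
- by move=> n; have /(congr1 f) := dualRE nz2 oddN prim n; rewrite !fE.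
- by move=> n nM; have /(congr1 f) := dualRS nz2 oddN prim nM; rewrite !fE.
Qed.

(** The defect vanishes at the node deformed to first order, that is in
    $F[X]/(X-1)^2$ at the point $q^{2r+2}X^2 + q^{-2r}X^{-2}$, where
    $X^{-1} = 2-X$.  The chain rule turns this into a statement about the
    derivative, with the speed of the deformed node as a factor. *)
Lemma defect_double_root r : root defect (eigen r) /\
  defect^`().[eigen r] * (2 * (q ^+ r.*2.+2 - (q ^+ r.*2)^-1)) = 0.
Proof.
pose e : {poly F} := 'X - 1%:P.
pose g := q ^+ r.*2.+2 *: 'X^2 + (q ^+ r.*2)^-1 *: (2%:P - 'X) ^+ 2.
suff /dvdpP[s sE] : e ^+ 2 %| defect \Po g.
  have g1 : g.[1] = eigen r.
    rewrite /g hornerD !hornerZ !horner_exp hornerD hornerN hornerC hornerX /eigen; ring.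
  have dg1 : g^`().[1] = 2 * (q ^+ r.*2.+2 - (q ^+ r.*2)^-1).
    rewrite /g derivD !derivZ !deriv_exp derivB derivC derivX.
    rewrite hornerD !hornerZ !hornerMn !hornerM !horner_exp hornerD !hornerN !hornerC.
    rewrite hornerX /= hornerD hornerN hornerC hornerX; ring.
  have e1 : e.[1] = 0 by rewrite /e hornerXsubC subrr.
  split; first by rewrite -g1 -root_comp sE /root hornerM horner_exp e1 expr0n mulr0.
  rewrite -g1 -dg1 -horner_comp -hornerM -deriv_comp sE.
  by rewrite derivM deriv_exp hornerD !hornerM !hornerMn !hornerM horner_exp e1; ring.
have e2s : (1 < size (e ^+ 2))%N by rewrite size_exp_XsubC.
have e2m : e ^+ 2 \is monic by rewrite monic_exp // monicXsubC.
rewrite -in_qpoly_eq0 // in_qpoly_comp_horner.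
set f := qpolyC (e ^+ 2); set pi := in_qpoly (e ^+ 2).
pose v := pi 'X; pose v' := pi (2%:P - 'X).
have pe : pi (e ^+ 2) = 0 by apply/eqP; rewrite in_qpoly_eq0.
have v0 : (1 - v) ^+ 2 = 0.
  rewrite -pe /v -(in_qpoly1 (e ^+ 2)) -rmorphB -rmorphXn; congr (pi _).
  rewrite /e; ring.
have vv : v * v' = 1.
  rewrite /v /v' -(in_qpoly1 (e ^+ 2)) -rmorphM; apply/eqP; rewrite -subr_eq0 -rmorphB.
  rewrite in_qpoly_eq0 //; apply/dvdpP; exists (-1); rewrite /e; ring.
pose y := (f q ^+ r * v) ^+ 2; pose y' := (f q^-1 ^+ r * v') ^+ 2.
have qq : f q * f q^-1 = 1 by rewrite -rmorphM divff ?rmorph1 // (q_neq0 prim).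
have yy : y * y' = 1 by rewrite -exprMn mulrACA vv -exprMn qq expr1n mulr1 expr1n.
have -> : pi g = f q ^+ 2 * y + y'.
  have fZ c p : pi (c *: p) = f c * pi p.
    rewrite /pi in_qpolyZ -mulr_algl; congr (_ * _).
    by apply: val_inj; rewrite /= alg_polyC.
  have piX p : pi (p ^+ 2) = pi p ^+ 2 by exact: rmorphXn.
  have piD p1 p2 : pi (p1 + p2) = pi p1 + pi p2 by exact: in_qpolyD.
  rewrite /g piD !fZ !piX -/v -/v' /y /y' !exprMn -!exprM muln2.
  have fX (x : F) k : f (x ^+ k) = f x ^+ k by exact: rmorphXn.
  rewrite -exprVn !fX -[r.*2.+2]addn2 [f q ^+ (_ + _)]exprD; ring.
rewrite /defect rmorphB !rmorphM hornerD hornerN !hornerM.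
rewrite !beta_poly_eval //.
rewrite subr_eq0; apply/eqP.
exact: beta_dual_orbit.
Qed.
End Defect.

Section Spectrum.
Variables (F : fieldType) (M : nat) (q : F).
Hypotheses (nz2 : 2%:R != 0 :> F) (oddN : odd M.+1) (prim : M.+1.-primitive_root q).

(** The symmetry behind all double roots: the nodes coincide in pairs, except
    for the middle one. *)
Lemma eigen_rev i : (i <= M)%N -> eigen q (M - i) = eigen q i.
Proof.
move=> iM; have q0 k : q ^+ k != 0 by rewrite expf_neq0 // (q_neq0 prim).
have E : q ^+ i.*2 * q ^+ (M - i).*2.+2 = 1.
  rewrite -exprD -[RHS](expr1n _ 2) -(prim_expr_order prim) -exprM.
  congr (_ ^+ _); clear -iM; lia.
have E2 : q ^+ i.*2.+2 * q ^+ (M - i).*2 = 1.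
  rewrite -exprD -[RHS](expr1n _ 2) -(prim_expr_order prim) -exprM.
  congr (_ ^+ _); clear -iM; lia.
rewrite /eigen addrC; congr (_ + _).
  by apply: (mulIf (q0 (M - i).*2)); rewrite mulVf // E2.
by apply: (mulfI (q0 i.*2)); rewrite mulfV // E.
Qed.

Lemma eigen_coef n : q ^+ n.*2 * eigen q n = 1 + q ^+ n.*2.*2.+2.
Proof.
rewrite /eigen mulrDr divff ?expf_neq0 ?(q_neq0 prim) // addrC.
by rewrite -exprD -[n.*2.*2]addnn !addnS.
Qed.

Lemma newton_eigen n :
  newton q n = (\prod_(0 <= i < n) - q ^+ i.*2) *: \prod_(0 <= i < n) ('X - (eigen q i)%:P).
Proof.
rewrite -scaler_prod; apply: eq_bigr => i _.
rewrite scalerBr -[_ *: (eigen q i)%:P]mul_polyC -polyCM scaleNr addrC.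
rewrite -polyCN; congr (_ + _%:P).
by rewrite mulNr opprK eigen_coef.
Qed.

Lemma prod_eigen_doubled :
  \prod_(0 <= i < M.+1) ('X - (eigen q i)%:P)
  = \prod_(x <- [seq eigen q i | i <- iota 0 (M./2).+1]) ('X - x%:P)
    * \prod_(x <- [seq eigen q i | i <- iota 0 M./2]) ('X - x%:P).
Proof.
have ME : M = (M./2 + M./2)%N.
  by rewrite addnn -[LHS]odd_double_half (negbTE (oddN : ~~ odd M)).
have iotaE n : iota 0 n = index_iota 0 n by rewrite /index_iota subn0.
rewrite !big_map !iotaE (@big_cat_nat _ _ _ (M./2).+1) //=; last by lia.
congr (_ * _); rewrite -[X in \prod_(X <= _ < _) _]add0n big_addn [RHS]big_nat_rev.
have -> : (M.+1 - (M./2).+1 = M./2)%N by lia.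
rewrite [RHS]big_nat [LHS]big_nat; apply: eq_bigr => i /andP[_ iM].
by rewrite -eigen_rev; [congr ('X - (eigen q _)%:P) |]; lia.
Qed.

(** The [M.+1] linear factors of [newton q M.+1] are the nodes of index at most
    [M./2], all but the last one repeated.  At the last one the deformation
    has speed zero, but a simple root is enough there. *)
Lemma newton_dvd_defect : newton q M.+1 %| defect M q.
Proof.
have ME : M = (M./2 + M./2)%N.
  by rewrite addnn -[LHS]odd_double_half (negbTE (oddN : ~~ odd M)).
have uniqE n : (n <= (M./2).+1)%N -> uniq [seq eigen q i | i <- iota 0 n].
  move=> nM; rewrite map_inj_in_uniq ?iota_uniq // => i j; rewrite !mem_iota => iM jM.
  have [->//|ij] := eqVneq i j.
  move=> eij; by apply: (eigen_inj oddN prim _ eij); lia.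
rewrite newton_eigen dvdpZl; last first.
  rewrite prodf_seq_neq0; apply/allP => i _.
  by rewrite oppr_eq0 expf_neq0 // (q_neq0 prim).
rewrite prod_eigen_doubled; apply: dvdp_double_roots; rewrite ?uniqE //.
- by move=> x /mapP [i iM ->]; apply: map_f; move: iM; rewrite !mem_iota; lia.
- by apply/allP => _ /mapP [i _ ->]; have [] := defect_double_root nz2 oddN prim i.
- apply/allP => x /mapP [k]; rewrite mem_iota => kM ->.
  have [_ /eqP] := defect_double_root nz2 oddN prim k.
  rewrite !mulf_eq0 (negbTE nz2) /= => /orP[//|].
  have q0 : q ^+ k.*2 != 0 by rewrite expf_neq0 // (q_neq0 prim).
  rewrite subr_eq0 => /eqP /(congr1 ( *%R (q ^+ k.*2))).
  rewrite divff // -exprD => /eqP.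
  have -> : (k.*2 + k.*2.+2 = k.*2.+1.*2)%N by lia.
  by rewrite (expq2_eq1 oddN prim) gtnNdvd //; lia.
Qed.
End Spectrum.

(** * The operator commuting with the Bailey chain *)

Section Op.
Variables (F : fieldType) (M : nat) (q : F).
Hypotheses (nz2 : 2%:R != 0 :> F) (oddN : odd M.+1) (prim : M.+1.-primitive_root q).

(** Generically the columns $1/((q^2)_{n-r}(q^4)_{n+r})$ (base $q^2$,
    multiplied by $(q^2;q^2)_n$), which diagonalise the Bailey chain, are
    eigenvectors of this bidiagonal matrix for the eigenvalues [eigen q r].
    Unlike them it still makes sense at a root of unity, where about half of those
    columns acquire poles. *)
Definition bailey_op : 'M[F]_M.+1 := \matrix_(i, j)
  ((i == j)%:R * eigen q j - (i == j.+1 :> nat)%:R * ((1 - q ^+ i.*2) / q ^+ i.*2)).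
(** Indexed by [nat], so that [ecol M.+1] is [0]. *)
Definition ecol k : 'cV[F]_M.+1 := \col_i (i == k :> nat)%:R.
Definition erow k : 'rV[F]_M.+1 := \row_i (i == k :> nat)%:R.

Lemma mul_ecol (A : 'M_M.+1) (k : 'I_M.+1) i : (A *m ecol k) i 0 = A i k.
Proof.
rewrite mxE (bigD1 k) //= big1 => [|j /negbTE jk]; rewrite !mxE ?eqxx ?mulr1 ?addr0 //.
by rewrite -[(j == k :> nat)]/(j == k) jk mulr0.
Qed.
Lemma mul_erow (A : 'M_M.+1) (k : 'I_M.+1) j : (erow k *m A) 0 j = A k j.
Proof.
rewrite mxE (bigD1 k) //= big1 => [|i /negbTE ik]; rewrite !mxE ?eqxx ?mul1r ?addr0 //.
by rewrite -[(i == k :> nat)]/(i == k) ik mul0r.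
Qed.

Lemma bailey_op_ecol k : (k <= M)%N ->
  bailey_op *m ecol k = eigen q k *: ecol k - ((1 - q ^+ k.*2.+2) / q ^+ k.*2.+2) *: ecol k.+1.
Proof.
move=> kM; apply/colP => i.
have {kM} kM : (k < M.+1)%N by [].
have -> : k = Ordinal kM by [].
rewrite mul_ecol !mxE /=; congr (_ + _); first by rewrite mulrC.
congr (- _); case: eqP => [->|]; last by rewrite mul0r mulr0.
by rewrite mul1r mulr1 doubleS.
Qed.

Lemma erow_bailey_op k : (k <= M)%N ->
  erow k *m bailey_op = eigen q k *: erow k - ((1 - q ^+ k.*2) / q ^+ k.*2) *: erow k.-1.
Proof.
move=> kM; apply/rowP => j.
have {kM} kM : (k < M.+1)%N by [].
have -> : k = Ordinal kM by [].
rewrite mul_erow !mxE /=; congr (_ + _).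
  rewrite -[(Ordinal kM == j)]/(k == j) [RHS]mulrC [k == _]eq_sym.
  by case: eqP => [->|]; rewrite ?mul0r.
congr (- _); case: k {kM} => [|k] /=; first by rewrite double0 expr0 subrr !mul0r.
by rewrite eqSS mulrC [_ == k]eq_sym.
Qed.

(** [ecol 0] is a cyclic vector: each factor of the Newton polynomial kills the
    diagonal entry met and moves one step down. *)
Lemma newton_ecol n : (n <= M.+1)%N ->
  horner_mx bailey_op (newton q n) *m ecol 0
  = (qpoch (q ^+ 2) (q ^+ 2) n / q ^+ n.*2) *: ecol n.
Proof.
elim: n => [|n IH] nM.
  by rewrite /newton big_geq // rmorph1 mul1mx qpoch0 expr0 divr1 scale1r.
rewrite /newton big_nat_recr //= -/(newton q n) mulrC rmorphM -mulmxA IH ?(ltnW nM) //.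
rewrite raddfB /= horner_mx_C horner_mxZ horner_mx_X.
rewrite -scalemxAr mulmxBl -scalemxAl bailey_op_ecol // mul_scalar_mx.
rewrite -(eigen_coef prim) !scalerBr !scalerA !mulrA opprB addrC subrK.
congr (_ *: _); rewrite qpochSr doubleS -exprS -exprM mul2n.
have q0 k : q ^+ k != 0 by rewrite expf_neq0 // (q_neq0 prim).
by field; rewrite !q0.
Qed.

(** [erow M] is cyclic on the other side.  Moving up from [M] meets the
    diagonal entries in reverse order, which is the same order by
    [eigen_rev]. *)
Lemma erow_newton n : (n <= M)%N ->
  erow M *m horner_mx bailey_op (newton q n)
  = ((-1) ^+ n * q ^+ (n * n.-1) * qpoch (q ^+ 2) (q ^+ 2) n) *: erow (M - n).
Proof.
elim: n => [|n IH] nM.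
  by rewrite /newton big_geq // rmorph1 mulmx1 qpoch0 !mul1r scale1r subn0.
rewrite /newton big_nat_recr //= -/(newton q n) rmorphM mulmxA IH ?(ltnW nM) //.
rewrite raddfB /= horner_mx_C horner_mxZ horner_mx_X.
rewrite -scalemxAl mulmxBr -scalemxAr erow_bailey_op ?leq_subr // mul_mx_scalar.
rewrite -(eigen_coef prim) (eigen_rev prim) ?(ltnW nM) //.
rewrite !scalerBr !scalerA !mulrA opprB addrC subrK -subnS.
congr (_ *: _); rewrite qpochSr -exprS -exprM mul2n.
have q0 k : q ^+ k != 0 by rewrite expf_neq0 // (q_neq0 prim).
have E : q ^+ (M - n).*2 * q ^+ n.*2.+2 = 1.
  rewrite -exprD -[RHS](expr1n _ 2) -(prim_expr_order prim) -exprM.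
  congr (_ ^+ _); clear -nM; lia.
have -> : (n.+1 * n.+1.-1 = n * n.-1 + n.*2)%N by case: (n) => //= k; clear; lia.
have -> : q ^+ (M - n).*2 = (q ^+ n.*2.+2)^-1.
  by apply: (mulIf (q0 n.*2.+2)); rewrite E mulVf.
rewrite exprD (exprS (-1)); field.
by rewrite q0 oner_eq0.
Qed.
End Op.

(** * Gaussian binomials and the transfer matrix *)

Section Gauss.
Variable F : fieldType.

(** q-Pascal induction: $1-X^{k+n}=(1-X^k)+X^k(1-X^n)$. *)
Lemma dvdp_qpochX n k :
  qpoch 'X 'X k * qpoch 'X 'X n %| (qpoch 'X 'X (k + n) : {poly F}).
Proof.
elim: n k => [|n IHn] k; first by rewrite qpoch0 mulr1 addn0.
elim: k => [|k IHk]; first by rewrite qpoch0 mul1r.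
rewrite addSn (qpochSr _ _ (k + n.+1)) -exprS.
have -> : 1 - 'X ^+ (k + n.+1).+1 =
   (1 - 'X ^+ k.+1) + 'X ^+ k.+1 * (1 - 'X ^+ n.+1) :> {poly F}.
  by rewrite -addSn exprD; ring.
rewrite mulrDr dvdp_add //.
  rewrite (qpochSr _ _ k) -exprS mulrAC; apply: dvdp_mul => //.
rewrite mulrCA dvdp_mull // addnS -addSn (qpochSr _ _ n) -exprS mulrA.
apply: dvdp_mul => //.
Qed.

Lemma qbinom_mul (q : F) n k : (k <= n)%N ->
  qbinom n k q * (qpoch q q (n - k) * qpoch q q k) = qpoch q q n.
Proof.
move=> kn; rewrite /qbinom /gauss_poly kn.
have ev m : (qpoch 'X 'X m).[q] = qpoch q q m.
  rewrite /qpoch horner_prod; apply: eq_bigr => i _.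
  by rewrite hornerD hornerC hornerN -exprS hornerXn exprS.
rewrite -!ev -!hornerM divpK // -{2}(subnK kn).
exact: dvdp_qpochX.
Qed.

Lemma qbinom_gt (q : F) n k : (n < k)%N -> qbinom n k q = 0.
Proof. by move=> nk; rewrite /qbinom /gauss_poly leqNgt nk /= horner0. Qed.
End Gauss.

Section Transfer.
Variables (F : fieldType) (M : nat) (q : F).
Hypotheses (oddN : odd M.+1) (prim : M.+1.-primitive_root q).

(** One link of the Bailey chain, from the smaller index [j] to the larger
    index [i]. *)
Definition chain (i j : nat) := q ^+ (2 * j ^ 2 + 2 * j) * qbinom i j (q ^+ 2).
Definition transfer : 'M[F]_M.+1 := \matrix_(i, j) chain i j.

Let Q0 n : (n <= M)%N -> qpoch (q ^+ 2) (q ^+ 2) n != 0.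
Proof. exact: qpoch_sq_neq0. Qed.
Let q0 k : q ^+ k != 0.
Proof. by rewrite expf_neq0 // (q_neq0 prim). Qed.
Let pS n : qpoch (q ^+ 2) (q ^+ 2) n.+1
   = qpoch (q ^+ 2) (q ^+ 2) n * (1 - q ^+ n.*2.+2).
Proof. by rewrite qpochSr -exprS -exprM mul2n. Qed.

Lemma qbinom_up n k : (k <= n)%N -> (n < M)%N ->
  (1 - q ^+ n.*2.+2) * qbinom n k (q ^+ 2)
  = (1 - q ^+ (n - k).*2.+2) * qbinom n.+1 k (q ^+ 2).
Proof.
move=> kn nM.
have h1 : qpoch (q ^+ 2) (q ^+ 2) (n - k) * qpoch (q ^+ 2) (q ^+ 2) k != 0.
  by rewrite mulf_neq0 // Q0 //; lia.
apply: (mulIf h1); rewrite -mulrA qbinom_mul //.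
have := qbinom_mul (q ^+ 2) (leqW kn); rewrite subSn // !pS => e.
by rewrite mulrC -e; ring.
Qed.

Lemma qbinom_right n k : (k < n)%N -> (n <= M)%N ->
  (1 - q ^+ k.*2.+2) * qbinom n k.+1 (q ^+ 2)
  = (1 - q ^+ (n - k).*2) * qbinom n k (q ^+ 2).
Proof.
move=> kn nM.
have h1 : qpoch (q ^+ 2) (q ^+ 2) (n - k.+1) * qpoch (q ^+ 2) (q ^+ 2) k != 0.
  by rewrite mulf_neq0 // Q0 //; lia.
apply: (mulIf h1).
have := qbinom_mul (q ^+ 2) kn; have := qbinom_mul (q ^+ 2) (ltnW kn).
rewrite pS -[(n - k)%N](subnSK kn) pS doubleS => e1 e2.
transitivity (qpoch (q ^+ 2) (q ^+ 2) n); first by rewrite -e2; ring.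
by rewrite -e1; ring.
Qed.

Lemma chain_gt i j : (i < j)%N -> chain i j = 0.
Proof. by move=> ij; rewrite /chain qbinom_gt // mulr0. Qed.

Lemma chain_comm i j : (i <= M)%N ->
  eigen q j * chain i j - (1 - q ^+ j.*2.+2) / q ^+ j.*2.+2 * chain i j.+1
  = eigen q i * chain i j - (1 - q ^+ i.*2) / q ^+ i.*2 * chain i.-1 j.
Proof.
move=> iM; have [ij|ji|->] := ltngtP i j.
- by rewrite !chain_gt ?mulr0 //; lia.
- case: i iM ji => // n nM; rewrite ltnS => jn.
  have := qbinom_right (jn : (j < n.+1)%N) nM; have := qbinom_up jn nM.
  rewrite /= /chain; set g := qbinom n.+1 j _; set R := qbinom _ j.+1 _; set U := qbinom n j _.
  have -> : (2 * j.+1 ^ 2 + 2 * j.+1 = 2 * j ^ 2 + 2 * j + j.*2.+2.*2)%N by lia.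
  rewrite (exprD q (2 * j ^ 2 + 2 * j)); set E := q ^+ (2 * j ^ 2 + 2 * j).
  rewrite subSn // doubleS => eU eR.
  have -> : (1 - q ^+ j.*2.+2) / q ^+ j.*2.+2 * (E * q ^+ j.*2.+2.*2 * R)
          = E * q ^+ j.*2.+2 * ((1 - q ^+ j.*2.+2) * R).
    by rewrite -[j.*2.+2.*2]addnn exprD; field; rewrite ?q0 ?oner_eq0.
  have -> : (1 - q ^+ n.*2.+2) / q ^+ n.*2.+2 * (E * U)
          = E / q ^+ n.*2.+2 * ((1 - q ^+ n.*2.+2) * U) by ring.
  rewrite eU eR.
  have -> : q ^+ (n - j).*2.+2 = q ^+ n.*2.+2 / q ^+ j.*2.
    by apply: (mulIf (q0 j.*2)); rewrite mulfVK // -exprD; congr (_ ^+ _); lia.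
  rewrite /eigen doubleS !exprS; field.
  by rewrite !q0 (q_neq0 prim).
- case: j => [|j] /=.
    by rewrite double0 expr0 subrr !mul0r (chain_gt (ltnSn 0)) mulr0.
  by rewrite (chain_gt (ltnSn j.+1)) (chain_gt (ltnSn j)) !mulr0.
Qed.

(** Entrywise this is [chain_comm].  The entry of index [M.+1] that the last
    column would need has coefficient [1 - q ^+ M.+1.*2], which is [0]. *)
Lemma transfer_comm : comm_mx transfer (bailey_op M q).
Proof.
apply/matrixP => i j.
have iM : (i <= M)%N := ltn_ord i; have jM : (j <= M)%N := ltn_ord j.
have TE k : (transfer *m ecol F M k) i 0 = if (k <= M)%N then chain i k else 0.
  case: leqP => [|Mk].
    by rewrite -ltnS => kM; rewrite -[k]/(val (Ordinal kM)) mul_ecol mxE.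
  rewrite mxE big1 // => l _; rewrite !mxE [_ == k]ltn_eqF ?mulr0 //.
  exact: leq_trans (ltn_ord l) Mk.
have eT k : (k <= M)%N -> (erow F M k *m transfer) 0 j = chain k j.
  by rewrite -ltnS => kM; rewrite -[k]/(val (Ordinal kM)) mul_erow mxE.
transitivity (eigen q j * chain i j - (1 - q ^+ j.*2.+2) / q ^+ j.*2.+2 * chain i j.+1).
  rewrite -mul_ecol -mulmxA (bailey_op_ecol _ jM) mulmxBr -!scalemxAr.
  rewrite mxE [X in _ + X]mxE [X in X - _]mxE [X in _ - X]mxE !TE jM.
  congr (_ - _); case: ltnP => // Mj.
  have -> : (j : nat) = M by apply/eqP; rewrite eqn_leq jM.
  rewrite -doubleS -mul2n mulnC exprM (prim_expr_order prim) expr1n subrr.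
  by rewrite !mul0r.
rewrite chain_comm // -mul_erow mulmxA (erow_bailey_op _ iM) mulmxBl -!scalemxAl.
rewrite [RHS]mxE [X in _ = _ + X]mxE [X in _ = X - _]mxE [X in _ = _ - X]mxE.
by rewrite !eT ?(leq_trans (leq_pred i)).
Qed.

End Transfer.

(** * Sums over nondecreasing tuples as matrix products *)

Section PathSum.
Variables (R : comNzRingType) (M : nat) (T : nat -> nat -> R) (u b : nat -> R).
Hypothesis T0 : forall i j, (i < j)%N -> T i j = 0.

Fixpoint pathprod x s := if s is y :: s' then T y x * pathprod y s' else 1.

Lemma pathprodE x s :
  pathprod x s = \prod_(0 <= i < size s) T (nth 0%N (x :: s) i.+1) (nth 0%N (x :: s) i).
Proof.
elim: s x => [|y s IH] x; first by rewrite big_geq.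
by rewrite /= big_nat_recl //= IH.
Qed.

Lemma pathprod_unsorted x s : ~~ path leq x s -> pathprod x s = 0.
Proof.
elim: s x => //= y s IH x; rewrite negb_and -ltnNge.
by case/orP => [/T0->|/IH->]; rewrite ?mul0r ?mulr0.
Qed.

Lemma sum_tuple_cons (A : finType) k (f : seq A -> R) :
  \sum_(n : k.+1.-tuple A) f n = \sum_x \sum_(t : k.-tuple A) f (x :: t).
Proof.
rewrite pair_bigA /= (reindex (fun p : A * k.-tuple A => [tuple of p.1 :: p.2])) //=.
exists (fun n => (thead n, [tuple of behead n])) => [[x t] _|n _].
  by congr (_, _); apply: val_inj.
by rewrite -tuple_eta.
Qed.

Definition rowv := \row_(i < M.+1) u i.
Definition colv := \col_(i < M.+1) b i.
Definition mxv := \matrix_(i < M.+1, j < M.+1) T i j.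

Lemma sum_tuple_path k (x : 'I_M.+1) :
  \sum_(t : k.-tuple 'I_M.+1) u (last (val x) (map val t)) * pathprod (val x) (map val t)
  = (rowv *m mxv ^+ k) 0 x.
Proof.
elim: k x => [|k IH] x.
  rewrite (eq_bigr (fun=> u x)) => [|t _]; last by rewrite tuple0 /= mulr1.
  by rewrite sumr_const card_tuple expn0 expr0 mulmx1 mxE.
rewrite (sum_tuple_cons _
  (fun t => u (last (val x) (map val t)) * pathprod (val x) (map val t))).
rewrite exprSr mulmxA mxE; apply: eq_bigr => y _.
rewrite -IH mxE mulr_suml; apply: eq_bigr => t _ /=.
by rewrite mulrCA mulrC.
Qed.

(** The monotonicity condition may be dropped from the range, because the
    weight of a tuple contains a factor [T i j] with [i < j] otherwise. *)
Lemma sum_nondecreasing k (f : nat -> nat -> R) :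
  (forall i j, (i <= j <= M)%N -> f i j = u j * b i) ->
  \sum_(n : k.+1.-tuple 'I_M.+1 | nondecreasing n)
     f (entry n 1) (entry n k.+1) * \prod_(1 <= i < k.+1) T (entry n i.+1) (entry n i)
  = (rowv *m mxv ^+ k *m colv) 0 0.
Proof.
move=> fE; rewrite big_mkcond /=.
pose g (s : seq 'I_M.+1) :=
  if map val s is x :: s' then u (last x s') * pathprod x s' * b x else 0.
rewrite (eq_bigr (fun n : k.+1.-tuple _ => g n)) => [|n _]; last first.
  rewrite /nondecreasing /entry /g; case/tupleP: n => x t /=.
  have st : size (map val t) = k by rewrite size_map size_tuple.
  have -> : \prod_(1 <= i < k.+1) T (nth 0%N (val x :: map val t) i)
                (nth 0%N (val x :: map val t) i.-1) = pathprod (val x) (map val t).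
    by rewrite pathprodE st big_add1.
  case: ifP => [xt|/negbT/pathprod_unsorted->]; last by rewrite mulr0 mul0r.
  have -> : nth 0%N (val x :: map val t) k = last (val x) (map val t).
    by rewrite (last_nth 0%N) st.
  rewrite fE; first by ring.
  apply/andP; split; last first.
    have : last (val x) (map val t) \in map val (x :: t) by apply: mem_last.
    by move=> /mapP [y _ ->]; apply: ltn_ord y.
  have := mem_last (val x) (map val t); rewrite inE => /predU1P[->//|].
  by move: xt => /(order_path_min leq_trans)/allP h /h.
rewrite sum_tuple_cons mxE; apply: eq_bigr => x _.
by rewrite [colv _ _]mxE -sum_tuple_path mulr_suml.
Qed.
End PathSum.

(** * Reflection of the largest index and conclusion *)

Section Final.
Variables (F : fieldType) (M : nat) (q : F).
Hypotheses (nz2 : 2%:R != 0 :> F) (oddN : odd M.+1) (prim : M.+1.-primitive_root q).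
Let q0 k : q ^+ k != 0.
Proof. by rewrite expf_neq0 // (q_neq0 prim). Qed.
Let qNS n : qpoch (- q) q n.+1 = qpoch (- q) q n * (1 + q ^+ n.+1).
Proof. by rewrite qpochSr mulNr opprK -exprS. Qed.

Lemma qpoch_cat (a : F) m n : qpoch a q (m + n) = qpoch a q m * qpoch (a * q ^+ m) q n.
Proof.
elim: n => [|n IH]; first by rewrite addn0 qpoch0 mulr1.
by rewrite addnS !qpochSr IH -!mulrA exprD.
Qed.

Lemma qpoch_neg_full : qpoch (- q) q M.+1 = 2.
Proof.
rewrite (@qpoch_prim F M q F idfun (- q) (- q)^-1) ?divff ?oppr_eq0 ?(q_neq0 prim) //.
by rewrite exprNn (prim_expr_order prim) -signr_odd oddN mulr1 opprK.
Qed.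

(** $(-q;q)_{2N-1} = 2$ at a root of unity of odd order $N$, and the factors
    removed from its end are $1+q^{-j}=q^{-j}(1+q^j)$. *)
Lemma qpoch_neg_reflect k l : (k + l = M.+1.*2.-1)%N ->
  qpoch (- q) q l * qpoch (- q) q k = 2 * q ^+ 'C(k.+1, 2).
Proof.
elim: k l => [|k IH] l kl.
  have lE : l.+1 = (M.+1 + M.+1)%N by lia.
  have q2N : q ^+ (M.+1 + M.+1) = 1 by rewrite exprD (prim_expr_order prim) mulr1.
  rewrite qpoch0 !mulr1; apply: (mulIf nz2).
  have := qNS l; rewrite lE q2N qpoch_cat (prim_expr_order prim) mulr1 qpoch_neg_full => <-.
  by [].
have {IH} := IH l.+1; rewrite addnS -addSn kl => /(_ erefl).
rewrite qNS => e; rewrite qNS (binS k.+1) bin1 exprD.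
have E : q ^+ l.+1 * q ^+ k.+1 = 1.
  by rewrite -exprD -[RHS](expr1n _ 2) -(prim_expr_order prim) -exprM; congr (_ ^+ _); lia.
have n1 : 1 + q ^+ l.+1 != 0 by apply: (one_plus_expq_neq0 nz2 oddN prim).
apply: (mulIf n1).
transitivity (2 * q ^+ 'C(k.+1, 2) * (1 + q ^+ k.+1)); first by rewrite -e; ring.
ring: E.
Qed.

(** The part of the summands that depends on the largest index. *)
Definition topL n := qpoch (- q) q n.*2.+1 * (-1) ^+ n * q ^- (n.+1 ^ 2).
Definition topR n := qpoch (- q) q n.*2 * (-1) ^+ n * q ^- (n ^ 2).

(** The row of weights is the last basis row acted upon by a polynomial in
    [bailey_op]; the coefficient of index [n] feeds the entry of index
    [M - n] by [erow_newton]. *)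
Lemma row_top_horner (top : nat -> F) c :
  (forall n, (n <= M)%N -> top (M - n)%N = 2 * (c n * q ^+ n.*2 *
     ((-1) ^+ n * q ^+ (n * n.-1) * qpoch (q ^+ 2) (q ^+ 2) n))) ->
  rowv M top = 2 *: (erow F M M *m horner_mx (bailey_op M q) (beta_poly M q c)).
Proof.
move=> tE.
rewrite /beta_poly rmorph_sum /= mulmx_sumr.
have iM (i : 'I_M.+1) : (i <= M)%N := ltn_ord i.
have termE (i j : 'I_M.+1) :
    (erow F M M *m horner_mx (bailey_op M q) ((c i * q ^+ i.*2) *: newton q i)) 0 j
    = (i == rev_ord j)%:R * (c i * q ^+ i.*2 *
     ((-1) ^+ i * q ^+ (i * i.-1) * qpoch (q ^+ 2) (q ^+ 2) i)).
  rewrite horner_mxZ -scalemxAr (erow_newton prim) // scalerA mxE mulrC.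
  rewrite [erow _ _ _ _ _]mxE; congr (_%:R * _); congr nat_of_bool.
  rewrite -[(i == _)]/(i == M.+1 - j.+1 :> nat)%N subSS.
  by move: (iM i) (iM j); clear; lia.
apply/rowP => j; rewrite !mxE summxE (bigD1 (rev_ord j)) // big1 => [|i /andP[_ ij]].
  have -> : top j = top (M - rev_ord j)%N by rewrite /= subSS subKn.
  by rewrite tE ?iM // termE eqxx /= mul1r addr0.
by rewrite termE (negbTE ij) mul0r.
Qed.

Lemma sign_rev n : (n <= M)%N -> (-1) ^+ (M - n) = (-1) ^+ n :> F.
Proof.
move=> nM; rewrite -signr_odd oddB // (negbTE (oddN : ~~ odd M)) addFb.
by rewrite signr_odd.
Qed.

Lemma exprq_sq_rev m n : (m + n = M.+1)%N -> q ^+ (m ^ 2) = q ^+ (n ^ 2).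
Proof.
move=> mn; have e : (m ^ 2 + n * M.+1.*2 = n ^ 2 + M.+1 * M.+1)%N by rewrite -mn; lia.
have q1 k : q ^+ (k * M.+1) = 1 by rewrite mulnC exprM (prim_expr_order prim) expr1n.
have : q ^+ (m ^ 2 + n * M.+1.*2) = q ^+ (n ^ 2 + M.+1 * M.+1) by rewrite e.
by rewrite !exprD q1 mulr1 -doubleMr doubleMl q1 mulr1.
Qed.

Lemma topL_dual n : (n <= M)%N -> topL (M - n) = 2 * (dualL q n * q ^+ n.*2 *
     ((-1) ^+ n * q ^+ (n * n.-1) * qpoch (q ^+ 2) (q ^+ 2) n)).
Proof.
move=> nM; rewrite /topL sign_rev // (@exprq_sq_rev _ n); last by clear -nM; lia.
have R : qpoch (- q) q (M - n).*2.+1 * qpoch (- q) q n.*2 = 2 * q ^+ 'C(n.*2.+1, 2).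
  by apply: qpoch_neg_reflect; clear -nM; lia.
have p0 : qpoch (- q) q n.*2 != 0 by apply: (qpoch_neg_neq0 nz2 oddN prim).
have Q0 := qpoch_sq_neq0 oddN prim nM.
apply: (mulIf p0); rewrite mulrAC [X in X * _]mulrAC R /dualL.
have -> : 'C(n.*2.+1, 2) = (n ^ 2 + n.*2 + n * n.-1)%N.
  by rewrite bin2odd /= ?odd_double // doubleK; case: (n) => // k; clear; lia.
rewrite !exprD; field.
by rewrite p0 Q0 q0.
Qed.

Lemma topR_dual n : (n <= M)%N -> topR (M - n) = 2 * (dualR q n * q ^+ n.*2 *
     ((-1) ^+ n * q ^+ (n * n.-1) * qpoch (q ^+ 2) (q ^+ 2) n)).
Proof.
move=> nM; rewrite /topR sign_rev // (@exprq_sq_rev _ n.+1); last by clear -nM; lia.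
have R : qpoch (- q) q (M - n).*2 * qpoch (- q) q n.*2.+1 = 2 * q ^+ 'C(n.*2.+2, 2).
  by apply: qpoch_neg_reflect; clear -nM; lia.
have p0 : qpoch (- q) q n.*2.+1 != 0 by apply: (qpoch_neg_neq0 nz2 oddN prim).
have Q0 := qpoch_sq_neq0 oddN prim nM.
apply: (mulIf p0); rewrite mulrAC [X in X * _]mulrAC R /dualR.
have -> : 'C(n.*2.+2, 2) = (n.+1 ^ 2 + n.*2 + n * n.-1)%N.
  by rewrite binS bin1 bin2odd /= ?odd_double // doubleK; case: (n) => // k; clear; lia.
rewrite !exprD; field.
by rewrite p0 Q0 q0.
Qed.

Lemma col_bottom_horner (bot : nat -> F) c :
  (forall n, (n <= M)%N -> bot n = c n * qpoch (q ^+ 2) (q ^+ 2) n) ->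
  colv M bot = horner_mx (bailey_op M q) (beta_poly M q c) *m ecol F M 0.
Proof.
move=> bE; rewrite /beta_poly rmorph_sum /= mulmx_suml.
apply/colP => i; rewrite mxE summxE (bigD1 i) //= big1 => [|j ji].
  rewrite horner_mxZ -scalemxAl (newton_ecol prim) ?(ltnW (ltn_ord i)) // !mxE eqxx.
  rewrite addr0 mulr1 bE; last exact: (ltn_ord i).
  by field; rewrite q0.
rewrite horner_mxZ -scalemxAl (newton_ecol prim) ?(ltnW (ltn_ord _)) // !mxE.
by rewrite eq_sym -[(j == i :> nat)]/(j == i) (negbTE ji) !mulr0.
Qed.

(** Every polynomial in [bailey_op] slides through the powers of the transfer
    matrix, so both sides differ by [defect] applied to [ecol 0], and a
    multiple of [newton q M.+1] annihilates that vector. *)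
Lemma sandwich_LR k :
  rowv M topL *m transfer M q ^+ k
    *m colv M (fun n => betaL q n * qpoch (q ^+ 2) (q ^+ 2) n)
  = rowv M topR *m transfer M q ^+ k
    *m colv M (fun n => betaR q n * qpoch (q ^+ 2) (q ^+ 2) n).
Proof.
have X0 : horner_mx (bailey_op M q) (defect M q) *m ecol F M 0 = 0.
  have /dvdpP[r ->] := newton_dvd_defect nz2 oddN prim.
  rewrite rmorphM -mulmxA (newton_ecol prim) //.
  have -> : qpoch (q ^+ 2) (q ^+ 2) M.+1 = 0.
    rewrite qpochSr -exprS -exprM mulnC exprM (prim_expr_order prim) expr1n subrr mulr0 //.
  by rewrite mul0r scale0r mulmx0.
have cT p : comm_mx (transfer M q ^+ k) (horner_mx (bailey_op M q) p).
  by apply/comm_mx_horner/comm_mx_sym/commrX/comm_mx_sym; apply: transfer_comm.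
have slide c d :
   (erow F M M *m horner_mx (bailey_op M q) (beta_poly M q d)) *m transfer M q ^+ k
     *m (horner_mx (bailey_op M q) (beta_poly M q c) *m ecol F M 0)
   = erow F M M *m transfer M q ^+ k
     *m (horner_mx (bailey_op M q) (beta_poly M q c * beta_poly M q d) *m ecol F M 0).
  rewrite mulrC rmorphM -!mulmxA; congr (_ *m _); rewrite !mulmxA -cT //.
rewrite (row_top_horner topL_dual) (row_top_horner topR_dual).
rewrite (col_bottom_horner (c := betaL q)) // (col_bottom_horner (c := betaR q)) //.
rewrite -!scalemxAl !slide; congr (_ *: _).
apply/eqP; rewrite -subr_eq0 -mulmxBr -mulmxBl -rmorphB -/(defect M q) X0 mulmx0 //.
Qed.
End Final.

Section Ends.
Variables (F : fieldType) (M : nat) (q : F).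
Hypotheses (nz2 : 2%:R != 0 :> F) (oddN : odd M.+1) (prim : M.+1.-primitive_root q).

Lemma summandL i j : (i <= j <= M)%N ->
  qpoch (- q ^+ (2 * i + 2)) q (2 * j - 2 * i) * (-1) ^+ j * q ^- ((j + 1) ^ 2)
    * qpoch (q ^+ 2) (q ^+ 2) i
  = topL q j * (betaL q i * qpoch (q ^+ 2) (q ^+ 2) i).
Proof.
move=> /andP[ij jM]; rewrite /topL /betaL addn1.
have -> : j.*2.+1 = (i.*2.+1 + (2 * j - 2 * i))%N by clear -ij; lia.
have -> : (2 * i + 2 = i.*2.+2)%N by clear; lia.
rewrite qpoch_cat mulNr -exprS; field.
by rewrite (qpoch_neg_neq0 nz2 oddN prim) expf_neq0 // (q_neq0 prim).
Qed.

Lemma summandR i j : (i <= j <= M)%N ->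
  qpoch (- q ^+ (2 * i + 1)) q (2 * j - 2 * i) * (-1) ^+ j * q ^- (j ^ 2)
    * qpoch q (q ^+ 2) i
  = topR q j * (betaR q i * qpoch (q ^+ 2) (q ^+ 2) i).
Proof.
move=> /andP[ij jM]; have iM := leq_trans ij jM; rewrite /topR /betaR /dualL.
have -> : j.*2 = (i.*2 + (2 * j - 2 * i))%N by clear -ij; lia.
have -> : (2 * i + 1 = i.*2.+1)%N by clear; lia.
rewrite qpoch_cat mulNr -exprS; field.
rewrite (qpoch_neg_neq0 nz2 oddN prim) (qpoch_sq_neq0 oddN prim iM).
by rewrite expf_neq0 // (q_neq0 prim).
Qed.
End Ends.

Theorem quantum_multisum (F : fieldType) (m N : nat) (q : F)
  (nz2 : 2%:R != 0 :> F) (hm : (1 <= m)%N) (hN : odd N) (hq : N.-primitive_root q) :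
  \sum_(n : m.-tuple 'I_N | nondecreasing n)
     qpoch (- q ^+ (2 * entry n 1 + 2)) q (2 * entry n m - 2 * entry n 1)
     * (-1) ^+ entry n m * q ^- ((entry n m + 1) ^ 2)
     * qpoch (q ^+ 2) (q ^+ 2) (entry n 1)
     * \prod_(1 <= i < m)
         (q ^+ (2 * entry n i ^ 2 + 2 * entry n i)
          * qbinom (entry n i.+1) (entry n i) (q ^+ 2))
  = \sum_(n : m.-tuple 'I_N | nondecreasing n)
     qpoch (- q ^+ (2 * entry n 1 + 1)) q (2 * entry n m - 2 * entry n 1)
     * (-1) ^+ entry n m * q ^- (entry n m ^ 2)
     * qpoch q (q ^+ 2) (entry n 1)
     * \prod_(1 <= i < m)
         (q ^+ (2 * entry n i ^ 2 + 2 * entry n i)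
          * qbinom (entry n i.+1) (entry n i) (q ^+ 2)).
Proof.
case: m hm => // k _; case: N hN hq => // M oddN prim.
have T0 i j : (i < j)%N -> chain q i j = 0 by apply: chain_gt.
transitivity ((rowv M (topL q) *m transfer M q ^+ k
  *m colv M (fun n => betaL q n * qpoch (q ^+ 2) (q ^+ 2) n)) 0 0).
  exact: (sum_nondecreasing T0 k (summandL nz2 oddN prim)).
rewrite (sandwich_LR nz2 oddN prim).
by symmetry; exact: (sum_nondecreasing T0 k (summandR nz2 oddN prim)).
Qed.

Theorem theorem1p4 (R : realType) (m N : nat) (q : R[i])
  (hm : (1 <= m)%N) (hN : odd N) (hq : N.-primitive_root q) :
  \sum_(n : m.-tuple 'I_N | nondecreasing n)
     qpoch (- q ^+ (2 * entry n 1 + 2)) q (2 * entry n m - 2 * entry n 1)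
     * (-1) ^+ entry n m * q ^- ((entry n m + 1) ^ 2)
     * qpoch (q ^+ 2) (q ^+ 2) (entry n 1)
     * \prod_(1 <= i < m)
         (q ^+ (2 * entry n i ^ 2 + 2 * entry n i)
          * qbinom (entry n i.+1) (entry n i) (q ^+ 2))
  = \sum_(n : m.-tuple 'I_N | nondecreasing n)
     qpoch (- q ^+ (2 * entry n 1 + 1)) q (2 * entry n m - 2 * entry n 1)
     * (-1) ^+ entry n m * q ^- (entry n m ^ 2)
     * qpoch q (q ^+ 2) (entry n 1)
     * \prod_(1 <= i < m)
         (q ^+ (2 * entry n i ^ 2 + 2 * entry n i)
          * qbinom (entry n i.+1) (entry n i) (q ^+ 2)).
Proof. by apply: quantum_multisum; rewrite // Num.Theory.pnatr_eq0. Qed.
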